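(* Let $A$ be an $n\times n$ matrix with nonnegative real entries and with tropical spectral radius $\lambda>0$, and let $\delta=\mathbf{1}^{T}(\lambda^{-1}A)^{\ast}\mathbf{1}$ (max-algebraic product). Consider the problem of minimizing $$\mathbf{1}^{T}xx^{-}\mathbf{1}$$ over all vectors $x\in\mathbb{R}_+^n$ with all entries positive that are of the form $x=(\lambda^{-1}A)^{\ast}u$ for some vector $u\in\mathbb{R}_+^n$ with all entries positive. Then the optimal (minimum) value of this problem equals $\delta$, and all positive solutions (i.e. exactly the feasible vectors attaining the minimum) are given by $$x=(\delta^{-1}\mathbf{1}\mathbf{1}^{T}\oplus\lambda^{-1}A)^{\ast}u,\qquad u\in\mathbb{R}_+^n,\ u>0 .$$
   Context: All operations are in the max-algebra (tropical algebra) on the nonnegative reals $\mathbb{R}_+=[0,\infty)$: addition is $a\oplus b=\max(a,b)$ and multiplication is ordinary multiplication. Matrix and vector operations are defined by the usual rules with $+$ replaced by $\oplus$, e.g. $(AB)_{ij}=\max_k a_{ik}b_{kj}$ and $(A\oplus B)_{ij}=\max(a_{ij},b_{ij})$; matrix powers $A^m$ are taken in this sense, with $A^0=I$ the usual identity matrix. $\mathbf{1}$ denotes the column vector in $\mathbb{R}^n_+$ with all entries equal to $1$, and $u>0$ means that all entries of $u$ are positive. For a nonzero column vector $x$, $x^{-}$ is the row vector with entries $x_i^{-1}$ if $x_i\ne 0$ and $0$ otherwise. Thus for positive $x$, $\mathbf{1}^{T}xx^{-}\mathbf{1}=(\max_i x_i)(\max_j 1/x_j)$. The tropical spectral radius of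 an $n\times n$ nonnegative matrix $A=(a_{ij})$ is the maximum cycle geometric mean $$\lambda=\max_{1\le k\le n}\ \max_{1\le i_1,\dots,i_k\le n}(a_{i_1i_2}a_{i_2i_3}\cdots a_{i_ki_1})^{1/k}.$$ The Kleene star of an $n\times n$ nonnegative matrix $M$ is $M^{\ast}=I\oplus M\oplus\cdots\oplus M^{n-1}$; it is used under the condition $\mathrm{Tr}(M)\le 1$, where $\mathrm{Tr}(M)=\max_{1\le r\le n}\max_{i}(M^{r})_{ii}$. *)

(* Defs.v *)
From mathcomp Require Import all_boot all_order all_algebra.
From mathcomp Require Import all_classical all_reals all_analysis.

Set Implicit Arguments.
Unset Strict Implicit.
Unset Printing Implicit Defensive.

Import Order.TTheory GRing.Theory Num.Theory.

Local Open Scope ring_scope.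

(* Max-algebra: a matrix over the nonnegative reals is a matrix A : 'M[R]_(m, n)
   with nonneg_mx A. On nonnegative entries 0 is the neutral element of
   Num.max, so it is the right default value for the iterated maxima below. *)

Section MaxAlgebra.
Variable R : realType.

Definition nonneg_mx m n (A : 'M[R]_(m, n)) : Prop := forall i j, 0 <= A i j.

Definition pos_mx m n (A : 'M[R]_(m, n)) : Prop := forall i j, 0 < A i j.

Definition tadd m n (A B : 'M[R]_(m, n)) : 'M[R]_(m, n) := map2_mx Num.max A B.

Definition tmul m n p (A : 'M[R]_(m, n)) (B : 'M[R]_(n, p)) : 'M[R]_(m, p) :=
  \matrix_(i, j) \big[Num.max/0]_(k < n) (A i k * B k j).

Definition tpow n (A : 'M[R]_n) (k : nat) : 'M[R]_n := iter k (tmul A) 1%:M.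

Definition kleene_star n (M : 'M[R]_n) : 'M[R]_n :=
  \big[@tadd n n/0]_(k < n) tpow M k.

(* Maximum over cycle lengths k.+1 = 1, ..., n and over all closed walks
   s 0, s 1, ..., s k, s 0 of the geometric mean of the entries; ordS is the
   cyclic successor on 'I_k.+1. *)
Definition tspectral_radius n (A : 'M[R]_n) : R :=
  \big[Num.max/0]_(k < n) \big[Num.max/0]_(s : {ffun 'I_k.+1 -> 'I_n})
    ((\prod_(j < k.+1) A (s j) (s (ordS j))) `^ (k.+1%:R^-1)).

Definition ones n : 'cV[R]_n := const_mx 1.

Definition conj_vec n (x : 'cV[R]_n) : 'rV[R]_n :=
  \row_i (if x i 0 != 0 then (x i 0)^-1 else 0).

End MaxAlgebra.

Arguments ones {R n}.

Declare Scope tropical_scope.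
Delimit Scope tropical_scope with T.
Notation "A ⊕ B" := (tadd A B)
  (at level 50, left associativity) : tropical_scope.
Notation "A ⊗ B" := (tmul A B)
  (at level 40, left associativity) : tropical_scope.

(* 1^T x x^- 1, a 1 x 1 matrix read as a scalar. *)
Definition objective (R : realType) n (x : 'cV[R]_n) : R :=
  (ones^T ⊗ x ⊗ conj_vec x ⊗ ones)%T 0 0.

Definition feasible (R : realType) n (A : 'M[R]_n) (x : 'cV[R]_n) : Prop :=
  pos_mx x /\
  exists u : 'cV[R]_n,
    pos_mx u /\ x = tmul (kleene_star ((tspectral_radius A)^-1 *: A)) u.

Definition is_solution (R : realType) T (S : T -> Prop) (f : T -> R) (x : T) :
  Prop := S x /\ forall y, S y -> f x <= f y.

Definition is_min_value (R : realType) T (S : T -> Prop) (f : T -> R) (v : R) :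
  Prop := (exists2 x, S x & f x = v) /\ forall y, S y -> v <= f y.

(* Main.v *)
Require Import Defs.
From mathcomp Require Import all_boot all_order all_algebra.
From mathcomp Require Import all_classical all_reals all_analysis.

Set Implicit Arguments.
Unset Strict Implicit.
Unset Printing Implicit Defensive.

Import Order.TTheory GRing.Theory Num.Theory.

Local Open Scope ring_scope.
Local Open Scope tropical_scope.

(** A positive [x] equals [M^* u] for some [u > 0] iff it is a subeigenvector:
    [M x <= x]. With [M = lambda^-1 A], a subeigenvector has
    [M^*_ij <= x_i / x_j], so its objective is at least [delta], the largest
    entry of [M^*], and it equals [delta] iff moreover [delta^-1 x_j <= x_i] for
    all [i, j], that is, iff [x] is a subeigenvector of
    [N = delta^-1 1 1^T + M]. The vector [M^* 1] has entries between 1 and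
    [delta], hence attains the minimum; being a positive subeigenvector of [N],
    it also shows that the cycles of [N] have weight at most 1. *)

Section Subeigenvectors.
Variables (R : realType) (n : nat).
Implicit Types (M : 'M[R]_n) (x u : 'cV[R]_n).

Definition subeigen M x : Prop := forall i j, M i j * x j 0 <= x i 0.

(** A walk is a total function on [nat], so that shifting and cutting it requires no casts between
    lengths; only [s 0], ..., [s k] matter. *)
Definition walk_weight M (s : nat -> 'I_n) (k : nat) : R :=
  \prod_(t < k) M (s t) (s t.+1).

(** For nonnegative [M] this is the condition $\mathrm{Tr}(M)\le 1$, read on closed walks. *)
Definition cycles_le1 M : Prop :=
  forall (s : nat -> 'I_n) (k : nat),
    (0 < k <= n)%N -> s k = s 0 -> walk_weight M s k <= 1.

(** * Max-algebraic products and powers *)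

Lemma tmul_le m p q (A : 'M[R]_(m, p)) (B : 'M[R]_(p, q)) i j (c : R) :
  0 <= c -> (forall k, A i k * B k j <= c) -> (A ⊗ B) i j <= c.
Proof. by move=> c0 le_c; rewrite mxE; apply: bigmax_le => // k _. Qed.

Lemma le_tmul m p q (A : 'M[R]_(m, p)) (B : 'M[R]_(p, q)) i j k :
  A i k * B k j <= (A ⊗ B) i j.
Proof. by rewrite mxE; apply: (le_bigmax _ (fun k => A i k * B k j)). Qed.

Lemma tmul_ge0 m p q (A : 'M[R]_(m, p)) (B : 'M[R]_(p, q)) :
  nonneg_mx (A ⊗ B).
Proof. by move=> i j; rewrite mxE; apply: bigmax_ge_id. Qed.

(** [Num.max] returns one of its arguments, so the iterated maximum is one of its terms or the
    default [0]. *)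
Lemma tmul_attained m p q (A : 'M[R]_(m, p)) (B : 'M[R]_(p, q)) i j :
  (A ⊗ B) i j = 0 \/ exists k, (A ⊗ B) i j = A i k * B k j.
Proof.
rewrite mxE; apply: (big_ind (fun y : R => y = 0 \/ exists k, y = A i k * B k j)).
- by left.
- by move=> y z Py Pz; rewrite /Num.max; case: ifP.
- by move=> k _; right; exists k.
Qed.

Lemma tpow_ge0 M k : nonneg_mx (tpow M k).
Proof.
by case: k => [|k] i j; [rewrite mxE ler0n | apply: tmul_ge0].
Qed.

(** A walk from [i] to [k] followed by one from [k] to [j] competes in the maximum over walks of
    length [a + b]. *)
Lemma tpowD_ge M a b i k j : nonneg_mx M ->
  tpow M a i k * tpow M b k j <= tpow M (a + b) i j.
Proof.
move=> M0; elim: a i => [|a IHa] i.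
  rewrite add0n [tpow M 0]/(1%:M) mxE.
  by case: eqP => [->|_]; rewrite ?mul1r // mul0r tpow_ge0.
rewrite addSn [tpow M a.+1]/(M ⊗ tpow M a).
have [->|[l ->]] := tmul_attained M (tpow M a) i k.
  by rewrite mul0r tpow_ge0.
rewrite -mulrA; apply: le_trans (le_tmul M (tpow M (a + b)) i j l).
by apply: ler_wpM2l; [exact: M0 | exact: IHa].
Qed.

(** * Walks and their weights *)

Lemma walk_weight_ge0 M s k : nonneg_mx M -> 0 <= walk_weight M s k.
Proof. by move=> M0; apply: prodr_ge0. Qed.

Lemma walk_weightD M s a b :
  walk_weight M s (a + b) =
  walk_weight M s a * walk_weight M (fun t => s (a + t)%N) b.
Proof.
rewrite /walk_weight big_split_ord; congr (_ * _).
by apply: eq_bigr => t _; rewrite /= addnS.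
Qed.

Lemma walk_weight_le_tpow M s k : nonneg_mx M ->
  walk_weight M s k <= tpow M k (s 0) (s k).
Proof.
move=> M0; elim: k s => [|k IHk] s.
  by rewrite /walk_weight big_ord0 /= mxE eqxx.
rewrite -add1n walk_weightD /walk_weight big_ord1.
apply: le_trans (le_tmul M (tpow M k) _ _ (s 1)).
by apply: ler_wpM2l; [exact: M0 | exact: (IHk (fun t => s (1 + t)%N))].
Qed.

Lemma tpow_walk M k i j : tpow M k i j = 0 \/
  exists s : nat -> 'I_n, [/\ s 0 = i, s k = j & tpow M k i j = walk_weight M s k].
Proof.
elim: k i => [|k IHk] i.
  rewrite [tpow M 0]/(1%:M) mxE; case: eqP => [->|_]; last by left.
  by right; exists (fun=> j); split; rewrite // /walk_weight big_ord0.
rewrite [tpow M k.+1]/(M ⊗ tpow M k).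
have [->|[l ->]] := tmul_attained M (tpow M k) i j; first by left.
have [->|[s [s0 sk ->]]] := IHk l; first by left; rewrite mulr0.
(* The optimal walk from the maximizing second vertex [l] is delayed by one, and [i] is put in
   front. *)
right; exists (fun t => if t is t'.+1 then s t' else i); split => //.
by rewrite -(add1n k) walk_weightD /walk_weight big_ord1 s0.
Qed.

(** * Kleene stars *)

Lemma kleene_starE M i j :
  kleene_star M i j = \big[Num.max/0]_(k < n) tpow M k i j.
Proof.
rewrite /kleene_star.
by apply: (big_morph (fun B : 'M[R]_n => B i j)) => [A B|]; rewrite mxE.
Qed.

Lemma le_kleene_star M k i j : (k < n)%N -> tpow M k i j <= kleene_star M i j.
Proof.
move=> ltkn; rewrite kleene_starE.
exact: (le_bigmax _ (fun k : 'I_n => tpow M k i j) (Ordinal ltkn)).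
Qed.

Lemma kleene_star_le M i j (c : R) : 0 <= c ->
  (forall k, (k < n)%N -> tpow M k i j <= c) -> kleene_star M i j <= c.
Proof.
by move=> c0 le_c; rewrite kleene_starE; apply: bigmax_le => // k _; apply: le_c.
Qed.

Lemma kleene_star_ge0 M : nonneg_mx (kleene_star M).
Proof. by move=> i j; rewrite kleene_starE; apply: bigmax_ge_id. Qed.

Lemma kleene_star_diag_ge1 M i : 1 <= kleene_star M i i.
Proof.
have n_gt0 : (0 < n)%N by apply: leq_ltn_trans (ltn_ord i).
by apply: le_trans (le_kleene_star M i i n_gt0); rewrite /= mxE eqxx.
Qed.

(* A walk of length [n] visits some vertex twice; cutting out the cycle in
   between does not decrease its weight. *)
Lemma tpow_dim_le_star M i j : nonneg_mx M -> cycles_le1 M ->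
  tpow M n i j <= kleene_star M i j.
Proof.
move=> M0 cycM; have [->|[s [s0 sn ->]]] := tpow_walk M n i j.
  exact: kleene_star_ge0.
have [p [q [ltpq leqn spq]]] : exists p q, [/\ (p < q)%N, (q <= n)%N & s p = s q].
  have /injectivePn[p [q neq_pq spq]] : ~~ injectiveb (fun t : 'I_n.+1 => s t).
    by apply/injectiveP => /leq_card; rewrite !card_ord ltnn.
  have [ltpq|ltqp|/val_inj eqpq] := ltngtP p q.
  - by exists p, q; split; rewrite // -ltnS.
  - by exists q, p; split; rewrite // -ltnS.
  - by rewrite eqpq eqxx in neq_pq.
set s1 := fun t => s (p + t)%N; set s2 := fun t => s (q + t)%N.
have -> : walk_weight M s n =
    walk_weight M s p * (walk_weight M s1 (q - p) * walk_weight M s2 (n - q)).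
  rewrite -{1}(subnKC leqn) walk_weightD -{1}(subnKC (ltnW ltpq)) walk_weightD.
  by rewrite mulrA.
apply: (@le_trans _ _ (tpow M p i (s p) * tpow M (n - q) (s p) j)).
  apply: ler_pM; rewrite ?mulr_ge0 ?walk_weight_ge0 -?s0 //.
    exact: walk_weight_le_tpow.
  rewrite -[leRHS]mul1r; apply: ler_pM; rewrite ?walk_weight_ge0 //.
    apply: cycM; first by rewrite subn_gt0 ltpq (leq_trans (leq_subr _ _)).
    by rewrite /s1 subnKC ?addn0 // ltnW.
  have := walk_weight_le_tpow s2 (n - q) M0.
  by rewrite /s2 addn0 subnKC // sn spq.
(* The shortened walk has length [p + (n - q)], which is below [n] because [p < q]. *)
apply: le_trans (tpowD_ge _ _ _ _ _ M0) (le_kleene_star _ _ _ _).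
by rewrite addnBA // ltn_subLR ?ltn_add2r // (leq_trans leqn) // leq_addl.
Qed.

(** Multiplying by [M] turns power [l] into [l.+1]; only [l = n - 1] leaves the range of the star,
    and [tpow_dim_le_star] covers that case. *)
Lemma kleene_star_subabsorb M i k j : nonneg_mx M -> cycles_le1 M ->
  M i k * kleene_star M k j <= kleene_star M i j.
Proof.
move=> M0 cycM; rewrite kleene_starE.
apply: (big_ind (fun y => M i k * y <= kleene_star M i j)) => [|y z|l _].
- by rewrite mulr0 kleene_star_ge0.
- by rewrite /Num.max; case: ifP.
- apply: le_trans (le_tmul M (tpow M l) i j k) _.
  rewrite -[M ⊗ _]/(tpow M l.+1).
  have := ltn_ord l; rewrite leq_eqVlt => /predU1P[->|ltln].
    exact: tpow_dim_le_star.
  exact: le_kleene_star.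
Qed.

(** * Subeigenvectors and images of Kleene stars *)

Lemma subeigen_tpow M x k i j : nonneg_mx M -> nonneg_mx x -> subeigen M x ->
  tpow M k i j * x j 0 <= x i 0.
Proof.
move=> M0 x0 Mx; elim: k i => [|k IHk] i.
  by rewrite /= mxE; case: eqP => [->|_]; rewrite ?mul1r // mul0r x0.
rewrite [tpow M k.+1]/(M ⊗ tpow M k).
have [->|[l ->]] := tmul_attained M (tpow M k) i j; first by rewrite mul0r x0.
rewrite -mulrA; apply: le_trans (Mx i l).
by apply: ler_wpM2l; [exact: M0 | exact: IHk].
Qed.

Lemma subeigen_star M x : nonneg_mx M -> nonneg_mx x -> subeigen M x ->
  subeigen (kleene_star M) x.
Proof.
move=> M0 x0 Mx i j; rewrite kleene_starE.
apply: (big_ind (fun y => y * x j 0 <= x i 0)) => [|y z|l _].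
- by rewrite mul0r x0.
- by rewrite /Num.max; case: ifP.
- exact: subeigen_tpow.
Qed.

(** For a subeigenvector, [u = x] works: the star does not increase [x], and its diagonal, at least
    1, does not decrease it. Conversely, [kleene_star_subabsorb] makes every image a
    subeigenvector. *)
Lemma pos_subeigen_image M x : nonneg_mx M -> cycles_le1 M ->
  (pos_mx x /\ subeigen M x) <->
  exists u, pos_mx u /\ x = kleene_star M ⊗ u.
Proof.
move=> M0 cycM; split=> [[x0 Mx]|[u [u0 ->]]].
  have x0' : nonneg_mx x by move=> i j; rewrite ltW.
  exists x; split=> //; apply/matrixP => i j; rewrite !ord1.
  apply: le_anti; apply/andP; split.
    apply: le_trans (le_tmul _ x i 0 i).
    by rewrite ler_peMl // kleene_star_diag_ge1.
  by apply: tmul_le => // k; apply: subeigen_star.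
split=> [i j|i j].
  apply: lt_le_trans (le_tmul _ u i j i); apply: mulr_gt0 => //.
  exact: lt_le_trans ltr01 (kleene_star_diag_ge1 M i).
have [->|[k ->]] := tmul_attained (kleene_star M) u j 0.
  by rewrite mulr0 tmul_ge0.
rewrite mulrA; apply: le_trans (le_tmul _ u i 0 k).
by apply: ler_wpM2r; [rewrite ltW | apply: kleene_star_subabsorb].
Qed.

(** Along a closed walk the inequalities chain to weight times [x (s k) 0] at most [x (s 0) 0], the
    same positive number, which cancels. *)
Lemma subeigen_cycles_le1 M x : nonneg_mx M -> pos_mx x -> subeigen M x ->
  cycles_le1 M.
Proof.
move=> M0 x0 Mx s k _ sk.
have x0' : nonneg_mx x by move=> i j; rewrite ltW.
rewrite -(ler_pM2r (x0 (s k) 0)) mul1r {2}sk.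
apply: le_trans (subeigen_tpow k (s 0) (s k) M0 x0' Mx).
by apply: ler_wpM2r; [exact: x0' | exact: walk_weight_le_tpow].
Qed.

(** * Spectral radius and objective *)

Lemma spectral_cycles_le1 (A : 'M[R]_n) : nonneg_mx A ->
  0 < tspectral_radius A -> cycles_le1 ((tspectral_radius A)^-1 *: A).
Proof.
set l := tspectral_radius A => A0 l0 s [//|k] /= ltkn sk.
have wA : walk_weight A s k.+1 <= l ^+ k.+1.
  have w0 : 0 <= walk_weight A s k.+1 by apply: walk_weight_ge0.
  have : walk_weight A s k.+1 `^ (k.+1%:R^-1) <= l.
    pose f := [ffun t : 'I_k.+1 => s t].
    have -> : walk_weight A s k.+1 = \prod_(j < k.+1) A (f j) (f (ordS j)).
      apply: eq_bigr => j _; rewrite !ffunE /=; congr (A _ _).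
      (* At the last index [ordS] wraps around to 0, which agrees with [s k.+1] because the walk is
         closed. *)
      have := ltn_ord j; rewrite leq_eqVlt => /predU1P[[->]|ltj].
        by rewrite modnn.
      by rewrite modn_small.
    rewrite /l /tspectral_radius.
    apply: le_trans (le_bigmax _ _ (Ordinal ltkn)).
    exact: (le_bigmax _ (fun s : {ffun 'I_k.+1 -> 'I_n} =>
      (\prod_(j < k.+1) A (s j) (s (ordS j))) `^ (k.+1%:R^-1)) f).
  move=> le_l; have -> : walk_weight A s k.+1 = (walk_weight A s k.+1 `^ k.+1%:R^-1) ^+ k.+1.
    by rewrite -powR_mulrn ?powR_ge0 // -powRrM mulVf ?pnatr_eq0 // powRr1.
  by apply: lerXn2r; rewrite ?nnegrE ?powR_ge0 // ltW.
have -> : walk_weight (l^-1 *: A) s k.+1 = l^-1 ^+ k.+1 * walk_weight A s k.+1.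
  rewrite /walk_weight -[in l^-1 ^+ _](card_ord k.+1) -prodrMl.
  by apply: eq_bigr => t _; rewrite mxE.
by rewrite exprVn ler_pdivrMl ?exprn_gt0 // mulr1.
Qed.

(** For positive [x] the objective is the largest ratio $x_i/x_j$. *)
Lemma objective_leP x (c : R) : pos_mx x -> 0 <= c ->
  objective x <= c <-> forall i j, x i 0 <= c * x j 0.
Proof.
move=> x0 c0; pose m := (ones^T ⊗ x).
have le_m i : x i 0 <= m 0 0.
  by have := le_tmul ones^T x 0 0 i; rewrite !mxE mul1r.
have cE j : conj_vec x 0 j = (x j 0)^-1 by rewrite mxE gt_eqF ?x0.
split=> [obj_le i j|le_c].
  rewrite -ler_pdivrMr ?x0 //; apply: le_trans obj_le.
  apply: le_trans (le_tmul _ _ 0 0 j); rewrite [ones j 0]mxE mulr1.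
  apply: le_trans (le_tmul _ _ 0 j 0); rewrite cE.
  by apply: ler_wpM2r; rewrite // invr_ge0 ltW.
apply: tmul_le => // j; rewrite [ones j 0]mxE mulr1.
apply: tmul_le => // l; rewrite [l]ord1 cE ler_pdivrMr //.
apply: tmul_le => [|i]; first by rewrite mulr_ge0 // ltW.
by rewrite !mxE mul1r.
Qed.

End Subeigenvectors.

Theorem corollary4p3 (R : realType) (n : nat) (A : 'M[R]_n) (lambda delta : R)
    (A_ge0 : nonneg_mx A)
    (lambdaE : lambda = tspectral_radius A) (lambda_gt0 : 0 < lambda)
    (deltaE : delta = (ones^T ⊗ kleene_star (lambda^-1 *: A) ⊗ ones) 0 0) :
  is_min_value (feasible A) (@objective R n) delta /\
  forall x : 'cV[R]_n,
    is_solution (feasible A) (@objective R n) x <->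
    exists u : 'cV[R]_n,
      pos_mx u /\
      x = kleene_star ((delta^-1 *: (ones ⊗ ones^T)) ⊕ (lambda^-1 *: A)) ⊗ u.
Proof.
set M := lambda^-1 *: A; set N := _ ⊕ M.
(* In dimension 0 the spectral radius would be an empty maximum, hence 0. *)
have n_gt0 : (0 < n)%N.
  move: lambda_gt0; rewrite lambdaE /tspectral_radius.
  by case: (n) A {A_ge0 lambdaE deltaE M N} => // A; rewrite big_ord0 ltxx.
pose i0 := Ordinal n_gt0.
have M0 : nonneg_mx M.
  by move=> i j; rewrite mxE mulr_ge0 // invr_ge0 ltW.
have cycM : cycles_le1 M.
  by rewrite /M lambdaE; apply: spectral_cycles_le1; rewrite -?lambdaE.
(* This bound and the next one identify [delta] as the largest entry of the star of [M]. *)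
have star_le_delta i j : kleene_star M i j <= delta.
  rewrite deltaE; apply: le_trans (le_tmul _ _ 0 0 j); rewrite [ones j 0]mxE mulr1.
  by apply: le_trans (le_tmul _ _ 0 j i); rewrite !mxE mul1r.
have delta_le c : 0 <= c -> (forall i j, kleene_star M i j <= c) -> delta <= c.
  move=> c0 le_c; rewrite deltaE; apply: tmul_le => // j.
  by rewrite [ones j 0]mxE mulr1; apply: tmul_le => // i; rewrite !mxE mul1r.
have delta_gt0 : 0 < delta.
  exact: lt_le_trans ltr01 (le_trans (kleene_star_diag_ge1 M i0) _).
have delta_ge0 := ltW delta_gt0.
have feasibleE x : feasible A x <-> pos_mx x /\ subeigen M x.
  rewrite /feasible -lambdaE -/M -(pos_subeigen_image _ M0 cycM).
  by split=> [[]|[]].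
(* The inner dimension of [ones ⊗ ones^T] is 1, so each entry is the maximum of 1 and the default
   0. *)
have NE i j : N i j = Num.max delta^-1 (M i j).
  rewrite !mxE big_ord_recl big_ord0 !mxE mul1r.
  by rewrite [Num.max 1 0]max_l ?mulr1.
have N0 : nonneg_mx N by move=> i j; rewrite NE le_max M0 orbT.
have NP x : (pos_mx x /\ subeigen N x) <-> feasible A x /\ objective x <= delta.
  rewrite feasibleE; split=> [[x0 Nx]|[[x0 Mx] /(objective_leP x0 delta_ge0) le_x]].
    split; last first.
      apply/objective_leP => // i j; rewrite -ler_pdivrMl //.
      by apply: le_trans (Nx j i); rewrite NE ler_wpM2r ?le_max ?lexx // ltW.
    split=> // i j; apply: le_trans (Nx i j).
    by rewrite NE ler_wpM2r ?le_max ?lexx ?orbT // ltW.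
  split=> // i j; rewrite NE /Num.max; case: ifP => _; first exact: Mx.
  by rewrite ler_pdivrMl.
have lower x : feasible A x -> delta <= objective x.
  move=> /feasibleE[x0 Mx]; have obj0 : 0 <= objective x by apply: tmul_ge0.
  apply: delta_le => // i j.
  have := subeigen_star M0 (fun i j => ltW (x0 i j)) Mx i j.
  rewrite -ler_pdivlMr // => /le_trans; apply; rewrite ler_pdivrMr //.
  by move: i j; apply/objective_leP.
pose x1 := kleene_star M ⊗ ones.
have x1F : feasible A x1.
  by apply/feasibleE/pos_subeigen_image => //; exists ones; split=> // i j; rewrite mxE.
have x1_le : objective x1 <= delta.
  have [x1_gt0 _] := x1F; apply/objective_leP => // i j.
  apply: (@le_trans _ _ delta).
    by apply: tmul_le => // k; rewrite [ones k 0]mxE mulr1.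
  rewrite ler_peMr //; apply: le_trans (le_tmul _ _ j 0 j).
  by rewrite [ones j 0]mxE mulr1 kleene_star_diag_ge1.
have cycN : cycles_le1 N.
  have /NP[x1_gt0 Nx1] : feasible A x1 /\ objective x1 <= delta by [].
  exact: subeigen_cycles_le1 Nx1.
split.
  split; last exact: lower.
  by exists x1 => //; apply: le_anti; rewrite x1_le lower.
(* What remains is that the minimizers are the feasible [x] with objective at most [delta]: compare
   with [x1] in one direction, use [lower] in the other. *)
move=> x; rewrite -(pos_subeigen_image x N0 cycN) NP.
split=> [[Fx min_x]|[Fx le_x]]; split=> //.
  exact: le_trans (min_x _ x1F) x1_le.
by move=> y /lower; apply: le_trans.
Qed.
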